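(* Let $\mu$ be a nonzero bounded $\mathbb{C}$-valued Borel measure on $[a,b]$, let $n\in\mathbb{N}$, let $k$ be an integer with $0\leq k<n$ and let $\gamma\in\mathbb{C}$. Assume that $$\int_{[a,b]}x^i\,d\mu(x)=0\qquad(i\in\{0,\dots,k-1\}),$$ $$\int_{[a,b]}\exp\Big(\sqrt[n-k]{\gamma}\,\exp\big(\tfrac{2j\pi}{n-k}\boldsymbol{i}\big)x\Big)\,d\mu(x)=0\qquad(j\in\{0,\dots,n-k-1\}).$$ Define $g:[a,b]\to\mathbb{C}$ by $$g(t):=\int_{[t,b]}\zeta'_{n,k,\gamma}(x-t)\,d\mu(x).$$ Then, for all $f\in\mathscr{C}^n_{\mathbb{C}}([a,b])$, $$\int_{[a,b]}f(x)\,d\mu(x)=\int_{[a,b]}\big(f^{(n)}(t)-\gamma f^{(k)}(t)\big)\cdot g(t)\,dt.$$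
   Context: $[a,b]$ is a compact interval; $\mathscr{C}^n_{\mathbb{C}}([a,b])$ is the space of $n$ times continuously differentiable complex-valued functions on $[a,b]$. $\boldsymbol{i}$ is the imaginary unit, and $\sqrt[n-k]{\gamma}$ denotes the root of order $(n-k)$ of $\gamma$ with the smallest nonnegative argument in the interval $[0,2\pi)$. The function $\zeta_{n,k,\gamma}:\mathbb{R}\to\mathbb{C}$ is defined by $$\zeta_{n,k,\gamma}(t):=\sum_{i=0}^\infty\frac{\gamma^i t^{i(n-k)+n}}{(i(n-k)+n)!}$$ (here $i$ is a summation index).
   Formalization: The formal theorem assumes γ ≠ 0 or n = 1; for γ = 0 and n ≥ 2 the claim is false, e.g. [a,b]=[0,1], n=2, k=0, μ=δ₀−δ₁, f(x)=x gives −1 on the left and 0 on the right. *)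

(* Defs.v *)
From HB Require Import structures.
From mathcomp Require Import all_boot all_order all_algebra.
From mathcomp Require Import all_classical all_reals all_analysis.
From mathcomp Require Import complex.

Set Implicit Arguments.
Unset Strict Implicit.
Unset Printing Implicit Defensive.

Import Order.TTheory GRing.Theory Num.Theory numFieldNormedType.Exports.

Local Open Scope classical_set_scope.
Local Open Scope ring_scope.
Local Open Scope complex_scope.

(* real-closed provides R[i] as a numClosedFieldType only; this equips it with
   the topology of the complex modulus. *)
HB.instance Definition _ (R : realType) := NormedModule.copy R[i] R[i]^o.

Lemma cvg_complex_Re (R : realType) (u : nat -> R[i]) (l : R[i]) :
  u @ \oo --> l -> (fun n => complex.Re (u n)) @ \oo --> complex.Re l.
Proof.
move=> /cvgrPdist_lt ul; apply/cvgrPdist_lt => e e0.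
have e0' : 0 < e%:C by rewrite ltcR.
near=> n; rewrite -ltcR.
have : `|l - u n| < e%:C by near: n; exact: ul.
by apply: le_lt_trans; rewrite -raddfB; exact: normc_ge_Re.
Unshelve. all: by end_near. Qed.

Lemma cvg_complex_Im (R : realType) (u : nat -> R[i]) (l : R[i]) :
  u @ \oo --> l -> (fun n => complex.Im (u n)) @ \oo --> complex.Im l.
Proof.
have norm_i : `|'i%C : R[i]| = 1.
  by rewrite normc_def /= expr0n expr1n add0r sqrtr1.
move=> /cvgrPdist_lt ul; apply/cvgrPdist_lt => e e0.
have e0' : 0 < e%:C by rewrite ltcR.
near=> n; rewrite -ltcR.
have : `|l - u n| < e%:C by near: n; exact: ul.
apply: le_lt_trans; rewrite -raddfB -normrN -ReiNIm.
by rewrite (le_trans (normc_ge_Re _))// normrM norm_i mulr1.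
Unshelve. all: by end_near. Qed.

Section complex_borel_measure.
Context {R : realType}.
Local Notation RB := (measurableTypeR R).

(* Bounded C-valued Borel measures on [a, b].  The Borel subsets of [a, b] are
   the Borel subsets of R contained in it; the values of the set function on
   other sets are irrelevant. *)
Record complex_borel_measure (a b : R) := ComplexBorelMeasure {
  cbm_fun :> set RB -> R[i] ;
  cbm_set0 : cbm_fun set0 = 0 ;
  cbm_sigma_additive : forall F : nat -> set RB,
    (forall i, measurable (F i)) -> (forall i, F i `<=` `[a, b]) ->
    trivIset [set: nat] F ->
    (fun n => \sum_(0 <= i < n) cbm_fun (F i)) @ \oo
      --> cbm_fun (\bigcup_i F i) ;
  cbm_bounded : exists M : R, forall A : set RB,
    measurable A -> A `<=` `[a, b] -> `|cbm_fun A| <= M%:C }.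

Variables (a b : R) (mu : complex_borel_measure a b).

Let sum_restr (F : nat -> set RB) :
  (forall i, measurable (F i)) -> trivIset [set: nat] F ->
  (fun n => \sum_(0 <= i < n) mu (F i `&` `[a, b])) @ \oo
    --> mu ((\bigcup_i F i) `&` `[a, b]).
Proof.
move=> mF tF; rewrite setI_bigcupl.
apply: (@cbm_sigma_additive _ _ mu (fun i => F i `&` `[a, b]%classic)).
- by move=> i; exact: measurableI.
- by move=> i x [].
- exact: trivIset_setIr.
Qed.

Definition re_charge (A : set RB) : \bar R :=
  (complex.Re (mu (A `&` `[a, b])))%:E.

Let re_charge0 : re_charge set0 = 0%E.
Proof. by rewrite /re_charge set0I cbm_set0. Qed.

Let re_charge_finite A : measurable A -> re_charge A \is a fin_num.
Proof. by []. Qed.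

Let re_charge_sigma_additive : semi_sigma_additive re_charge.
Proof.
move=> F mF tF _.
rewrite (_ : (fun n => _) = (fun n =>
    (complex.Re (\sum_(0 <= i < n) mu (F i `&` `[a, b])))%:E)).
  by apply: cvg_EFin; [exact: nearW|exact: cvg_complex_Re (sum_restr mF tF)].
by apply/funext => n; rewrite raddf_sum sumEFin.
Qed.

HB.instance Definition _ := isCharge.Build _ _ _ re_charge
  re_charge0 re_charge_finite re_charge_sigma_additive.

Definition im_charge (A : set RB) : \bar R :=
  (complex.Im (mu (A `&` `[a, b])))%:E.

Let im_charge0 : im_charge set0 = 0%E.
Proof. by rewrite /im_charge set0I cbm_set0. Qed.

Let im_charge_finite A : measurable A -> im_charge A \is a fin_num.
Proof. by []. Qed.

Let im_charge_sigma_additive : semi_sigma_additive im_charge.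
Proof.
move=> F mF tF _.
rewrite (_ : (fun n => _) = (fun n =>
    (complex.Im (\sum_(0 <= i < n) mu (F i `&` `[a, b])))%:E)).
  by apply: cvg_EFin; [exact: nearW|exact: cvg_complex_Im (sum_restr mF tF)].
by apply/funext => n; rewrite raddf_sum sumEFin.
Qed.

HB.instance Definition _ := isCharge.Build _ _ _ im_charge
  im_charge0 im_charge_finite im_charge_sigma_additive.

End complex_borel_measure.

Section integrals.
Context {R : realType}.
Local Notation RB := (measurableTypeR R).

(* Integral of a real function against a finite signed measure, through the
   Jordan decomposition; the result does not depend on the chosen Hahn
   decomposition (P, N). *)
Definition charge_integral (nu : {charge set RB -> \bar R}) (D : set RB)
    (f : RB -> R) : R :=
  let: exist P exN := cid (Hahn_decomposition nu) in
  let: exist N nuPN := cid exN in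
  \int[jordan_pos nuPN]_(x in D) f x - \int[jordan_neg nuPN]_(x in D) f x.

Definition complex_integral (a b : R) (mu : complex_borel_measure a b)
    (D : set RB) (f : RB -> R[i]) : R[i] :=
  let u x := complex.Re (f x) in
  let v x := complex.Im (f x) in
  (charge_integral (re_charge mu) D u - charge_integral (im_charge mu) D v) +i*
  (charge_integral (re_charge mu) D v + charge_integral (im_charge mu) D u).

Definition complex_lebesgue_integral (D : set RB) (f : RB -> R[i]) : R[i] :=
  (\int[lebesgue_measure]_(x in D) complex.Re (f x)) +i*
  (\int[lebesgue_measure]_(x in D) complex.Im (f x)).

End integrals.

Section calculus.
Context {R : realType}.

(* Derivative along D of a C-valued function of a real variable; at an end point
   of an interval D this is the one-sided derivative. *)
Definition diff_quotient (f : R -> R[i]) (t x : R) : R[i] :=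
  (f x - f t) / (x - t)%:C.

Definition cderivable (D : set R) (f : R -> R[i]) (t : R) : Prop :=
  cvg (diff_quotient f t x @[x --> within D t^']).

Definition cderiv (D : set R) (f : R -> R[i]) (t : R) : R[i] :=
  lim (diff_quotient f t x @[x --> within D t^']).

Definition cderivn (D : set R) (m : nat) (f : R -> R[i]) : R -> R[i] :=
  iter m (cderiv D) f.

(* A function on D is represented by any extension f to the whole of R: only
   the values of f on D matter for membership and, on D, for cderivn. *)
Definition class_C (D : set R) (n : nat) (f : R -> R[i]) : Prop :=
  (forall m, (m < n)%N -> forall t, D t -> cderivable D (cderivn D m f) t) /\
  {within D, continuous (cderivn D n f)}.

Definition cexp (z : R[i]) : R[i] :=
  limn (series (fun m => z ^+ m / m`!%:R)).

Definition zeta (n k : nat) (gamma : R[i]) (t : R) : R[i] :=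
  limn (series (fun i =>
    gamma ^+ i * t%:C ^+ (i * (n - k) + n) / (i * (n - k) + n)`!%:R)).

End calculus.

(* Main.v *)
(* Put zeta' = sum_N c_N t^N / N!. Its coefficients satisfy
   c_(N+n) = gamma c_(N+k), c_0 = ... = c_(n-2) = 0 and c_(n-1) = 1, i.e. zeta'
   is the Green function of D^n - gamma D^k. Integrating by parts in
   int_a^x (f^(n) - gamma f^(k))(t) zeta'(x - t) dt gives
     f x = P x + int_a^x (f^(n) - gamma f^(k))(t) zeta'(x - t) dt,
   where P is a combination of the functions sum_N c_(N+j) (x - a)^N / N!.
   The sequences N |-> c_(N+j) satisfy the same recurrence, hence are
   combinations of the powers lambda^N of the (n-k)-th roots lambda of gamma
   and of sequences supported on N < k; by the moment hypotheses mu annihilates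
   P. Integrating the identity against mu and applying Fubini's theorem gives
   the result. *)
Require Import Defs.
From mathcomp Require Import all_boot all_order all_algebra.
From mathcomp Require Import all_classical all_reals all_analysis.
From mathcomp Require Import complex.
From mathcomp Require Import ring lra zify measurable_realfun.

Set Implicit Arguments.
Unset Strict Implicit.
Unset Printing Implicit Defensive.

Import Order.TTheory GRing.Theory Num.Theory numFieldNormedType.Exports.

Local Open Scope classical_set_scope.
Local Open Scope ring_scope.
Local Open Scope complex_scope.

(** The hypothesis on [gamma] is the crux of the annihilation step. For [gamma = 0] every root is 0
    and the exponential conditions only say that mu has total mass 0, while P may be any polynomial
    of degree below n. If n > 1, the monomial of degree n - 1 is then left untested; if n = 1, the
    only monomial is the constant. Functions are handled through their Taylor coefficients, so that
    differentiation is the index shift and a differential equation is a recurrence. For N >= k the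
    recurrence reads c_(N+n-k) = gamma c_N: a window of n - k values fixes the tail, and a discrete
    Fourier transform on it produces the exponentials. Fubini's theorem concerns positive measures,
    and the kernel lives on the triangle a <= t <= x <= b. Hence mu is split into four finite
    positive measures, and the kernel is replaced by a bounded measurable function on the plane that
    vanishes on the rest of the square. *)

Local Notation Re := complex.Re.
Local Notation Im := complex.Im.

(** * Calculus of complex-valued functions of a real variable *)

Section complex_limits.
Context {R : realType}.

Lemma normc_ge_Im (z : R[i]) : `|Im z|%:C <= `|z|.
Proof.
rewrite -normrN -ReiNIm (le_trans (normc_ge_Re _))// normrM.
by rewrite [X in _ * X]normc_def /= expr0n expr1n add0r sqrtr1 mulr1.
Qed.

(** Both parts are bounded by the modulus; conversely [f] is rebuilt from its parts, and the
    embedding of the reals is an isometry. *)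
Lemma cvg_complexP T (F : set_system T) {FF : Filter F} (f : T -> R[i]) l :
  f @ F --> l <->
  (fun x => Re (f x)) @ F --> Re l /\ (fun x => Im (f x)) @ F --> Im l.
Proof.
split=> [/cvgrPdist_lt fl|[fRe fIm]].
  have near_lt (e : R) : 0 < e -> \forall x \near F, `|l - f x| < e%:C.
    by move=> e0; apply: fl; rewrite ltcR.
  split; apply/cvgrPdist_lt => e /near_lt; apply: filterS => x lfx.
    by rewrite -ltcR (le_lt_trans _ lfx)// -raddfB normc_ge_Re.
  by rewrite -ltcR (le_lt_trans _ lfx)// -raddfB normc_ge_Im.
have toC (g : T -> R) (m : R) :
    g @ F --> m -> (fun x => (g x)%:C : R[i]) @ F --> (m%:C : R[i]).
  move=> /cvgrPdist_lt gm; apply/cvgrPdist_lt => e; rewrite ltcE /=.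
  (* In the order of [R[i]], [0 < e] forces [e] to be real. *)
  case: e => e e' /= /andP[/eqP -> e0].
  move: (gm _ e0); apply: filterS => x.
  by rewrite -ltcR -rmorphB normc_def /= expr0n addr0 sqrtr_sqr.
rewrite (_ : f = fun x => (Re (f x))%:C + 'i%C * (Im (f x))%:C); last first.
  by apply/funext => x; rewrite -complexE.
rewrite [l]complexE; apply: cvgD; first exact: toC.
by apply: cvgM; [exact: cvg_cst|exact: toC].
Qed.

Lemma within_continuous_complexP (D : set R) (f : R -> R[i]) :
  {within D, continuous f} <->
  {within D, continuous (fun x => Re (f x))} /\
  {within D, continuous (fun x => Im (f x))}.
Proof.
split=> [/subspace_continuousP fc|[/subspace_continuousP fRe]].
  by split; apply/subspace_continuousP => x /fc /cvg_complexP[].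
move=> /subspace_continuousP fIm; apply/subspace_continuousP => x Dx.
by apply/cvg_complexP; split; [exact: fRe|exact: fIm].
Qed.

Lemma cvg_complexM T (F : set_system T) {FF : Filter F} (f g : T -> R[i]) (k l : R[i]) :
  f @ F --> k -> g @ F --> l -> (fun x => f x * g x) @ F --> k * l.
Proof. by move=> fk gl; apply: (@cvgM R[i] T F FF f g k l fk gl). Qed.

Lemma cvg_complexD T (F : set_system T) {FF : Filter F} (f g : T -> R[i]) (k l : R[i]) :
  f @ F --> k -> g @ F --> l -> (fun x => f x + g x) @ F --> k + l.
Proof. by move=> fk gl; apply: (@cvgD R[i] R[i]^o T F FF f g k l fk gl). Qed.

Lemma cvg_complex_lim T (F : set_system T) {FF : ProperFilter F} (f : T -> R[i])
  (l : R[i]) : f @ F --> l -> lim (f @ F) = l.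
Proof. by move=> fl; exact: (@norm_cvg_lim R[i] R[i]^o _ _ l fl). Qed.

(** Relational form of [cderiv]: naming the limit spares the calculus rules any existence proof. At
    a point isolated in [D] it holds for every [l]. *)
Definition has_cderiv (D : set R) (f : R -> R[i]) (t : R) (l : R[i]) : Prop :=
  diff_quotient f t x @[x --> within D t^'] --> l.


(** Carathéodory's criterion is the bridge: its continuous factor is the difference quotient
    completed by [l] at [t]. *)
Lemma real_derive_quotient (f : R -> R) (t l : R) :
  is_derive t 1 f l <-> (f x - f t) / (x - t) @[x --> t^'] --> l.
Proof.
split=> [/is_derive1_caratheodory [g [gE gc <-]]|fl].
  move/continuous_withinNx : gc; apply: cvg_trans; apply: near_eq_cvg.
  near=> x; rewrite gE mulfK// subr_eq0.
  by near: x; exact: nbhs_dnbhs_neq.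
apply/is_derive1_caratheodory.
exists (fun x => if x == t then l else (f x - f t) / (x - t)).
split; last by rewrite eqxx.
  move=> z; case: eqVneq => [->|zt]; first by rewrite !subrr mulr0.
  by rewrite divfK// subr_eq0.
apply/continuous_withinNx; rewrite eqxx.
move: fl; apply: cvg_trans; apply: near_eq_cvg; near=> x.
rewrite ifF//; apply/negbTE.
by near: x; exact: nbhs_dnbhs_neq.
Unshelve. all: by end_near. Qed.

Lemma Re_divR (z : R[i]) (x : R) : Re (z / x%:C) = Re z / x.
Proof. by rewrite -fmorphV; case: z => u v /=; rewrite mulr0 subr0. Qed.

Lemma Im_divR (z : R[i]) (x : R) : Im (z / x%:C) = Im z / x.
Proof. by rewrite -fmorphV; case: z => u v /=; rewrite mulr0 add0r. Qed.

Lemma is_derive_has_cderiv (D : set R) (f : R -> R[i]) (t : R) (l : R[i]) :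
  is_derive t 1 (fun x => Re (f x)) (Re l) ->
  is_derive t 1 (fun x => Im (f x)) (Im l) -> has_cderiv D f t l.
Proof.
move=> /real_derive_quotient fRe /real_derive_quotient fIm.
apply: (@cvg_trans _ (diff_quotient f t x @[x --> t^'])).
  by apply: cvg_within_filter; exact: cvg_id.
apply/cvg_complexP; split.
  by under eq_fun do rewrite /diff_quotient Re_divR raddfB.
by under eq_fun do rewrite /diff_quotient Im_divR raddfB.
Qed.

Lemma has_cderiv_is_derive (D : set R) (f : R -> R[i]) (t : R) (l : R[i]) :
  D° t -> has_cderiv D f t l ->
  is_derive t 1 (fun x => Re (f x)) (Re l) /\
  is_derive t 1 (fun x => Im (f x)) (Im l).
Proof.
move=> Dt fl.
have : diff_quotient f t x @[x --> t^'] --> l.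
  have Dnear : \forall x \near t^', D x by exact: (nbhs_dnbhs Dt).
  by move=> U /fl; apply: filterS2 Dnear => x Dx; exact.
move/cvg_complexP => [fRe fIm]; split; apply/real_derive_quotient.
  by under eq_fun do rewrite -raddfB -Re_divR.
by under eq_fun do rewrite -raddfB -Im_divR.
Qed.

Lemma has_cderiv_subset (D E : set R) (f : R -> R[i]) (t : R) l : D `<=` E ->
  has_cderiv E f t l -> has_cderiv D f t l.
Proof.
move=> DE; apply: cvg_trans => U; rewrite /= !near_simpl.
exact: (within_subset _ DE).
Qed.

Lemma has_cderiv_cvg (D : set R) (f : R -> R[i]) (t : R) l :
  has_cderiv D f t l -> f x @[x --> within D t^'] --> f t.
Proof.
move=> fl.
have xt : ((x - t)%:C : R[i]) @[x --> within D t^'] --> (0 : R[i]).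
  apply/cvg_complexP; split => /=; last exact: cvg_cst.
  rewrite -(subrr t); apply: cvgB; last exact: cvg_cst.
  by apply: cvg_within_filter; apply: cvg_within.
have -> : f t = f t + l * 0 by rewrite mulr0 addr0.
have : f t + diff_quotient f t x * (x - t)%:C @[x --> within D t^'] --> f t + l * 0.
  apply: cvg_complexD; first exact: cvg_cst.
  by apply: cvg_complexM; [exact: fl|exact: xt].

apply: cvg_trans; apply: near_eq_cvg; apply: cvg_within.
near=> x; rewrite /diff_quotient divfK; first by rewrite addrC subrK.
by rewrite fmorph_eq0 subr_eq0; near: x; exact: nbhs_dnbhs_neq.
Unshelve. all: by end_near. Qed.

Lemma has_cderiv_continuous (D : set R) (f f' : R -> R[i]) :
  (forall t, D t -> has_cderiv D f t (f' t)) -> {within D, continuous f}.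
Proof.
move=> ff'; apply/subspace_continuousP => t Dt.
move=> U Uft.
have Unear : nbhs t (fun x => x != t -> D x -> U (f x)).
  exact: (has_cderiv_cvg (ff' _ Dt) Uft).
suff : nbhs t (fun x => D x -> U (f x)) by [].
apply: filterS Unear => x; case: (eqVneq x t) => [-> _ _|xt Ux Dx].
  exact: nbhs_singleton.
exact: Ux.
Qed.

Lemma has_cderiv_cst (D : set R) (c : R[i]) (t : R) :
  has_cderiv D (fun=> c) t 0.
Proof.
by rewrite /has_cderiv /diff_quotient; under eq_fun do rewrite subrr mul0r; exact: cvg_cst.
Qed.

Lemma has_cderivD (D : set R) (f g : R -> R[i]) (t : R) k l :
  has_cderiv D f t k -> has_cderiv D g t l ->
  has_cderiv D (fun x => f x + g x) t (k + l).
Proof.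
move=> fk gl; rewrite /has_cderiv /diff_quotient.
by under eq_fun do rewrite opprD addrACA mulrDl; apply: cvg_complexD; [exact: fk|exact: gl].
Qed.

Lemma has_cderivM (D : set R) (f g : R -> R[i]) (t : R) k l :
  has_cderiv D f t k -> has_cderiv D g t l ->
  has_cderiv D (fun x => f x * g x) t (k * g t + f t * l).
Proof.
move=> fk gl; rewrite /has_cderiv.
rewrite (_ : diff_quotient _ t = fun x => diff_quotient f t x * g x +
    f t * diff_quotient g t x).
  apply: cvg_complexD; apply: cvg_complexM.
  - exact: fk.
  - exact: has_cderiv_cvg gl.
  - exact: cvg_cst.
  - exact: gl.
apply/funext => x; rewrite /diff_quotient mulrAC mulrA -mulrDl; congr (_ / _).
by rewrite mulrBl mulrBr addrA subrK.
Qed.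

Lemma has_cderivZ (D : set R) (c : R[i]) (f : R -> R[i]) (t : R) l :
  has_cderiv D f t l -> has_cderiv D (fun x => c * f x) t (c * l).
Proof.
move=> fl; rewrite -[c * l]add0r -(mul0r (f t)).
by apply: has_cderivM; [exact: has_cderiv_cst|exact: fl].
Qed.

Lemma has_cderiv_sum (D : set R) n (f : 'I_n -> R -> R[i]) (t : R) (l : 'I_n -> R[i]) :
  (forall i, has_cderiv D (f i) t (l i)) ->
  has_cderiv D (fun x => \sum_(i < n) f i x) t (\sum_(i < n) l i).
Proof.
move=> fl; elim: n f l fl => [|n IHn] f l fl.
  by rewrite big_ord0; under eq_fun do rewrite big_ord0; exact: has_cderiv_cst.
rewrite big_ord_recl; under eq_fun do rewrite big_ord_recl.
by apply: has_cderivD; [exact: fl|apply: IHn => i; exact: fl].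
Qed.

(** One-sided derivatives at the end points give continuity of [F] there; inside, [F] is
    differentiable in the ordinary sense, so the real theorem applies to both parts. *)
Lemma complex_FTC (a b : R) (F f : R -> R[i]) : a < b ->
  (forall t, `[a, b]%classic t -> has_cderiv `[a, b] F t (f t)) ->
  {within `[a, b], continuous f} ->
  complex_lebesgue_integral `[a, b] f = F b - F a.
Proof.
move=> ab dF fc.
have Fc := has_cderiv_continuous dF.
have dFo t : t \in `]a, b[ -> is_derive t 1 (fun x => Re (F x)) (Re (f t)) /\
    is_derive t 1 (fun x => Im (F x)) (Im (f t)).
  move=> tab; apply: (@has_cderiv_is_derive `[a, b]); last first.
    by apply: dF => /=; exact: subset_itv_oo_cc.
  rewrite /interior /=; near=> x; apply: subset_itv_oo_cc.
  by near: x; exact: near_in_itvoo.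
have real_FTC (p : R[i] -> R) : {morph p : x y / x - y} ->
    {within `[a, b], continuous (fun x => p (f x))} ->
    {within `[a, b], continuous (fun x => p (F x))} ->
    (forall t, t \in `]a, b[ -> is_derive t 1 (fun x => p (F x)) (p (f t))) ->
    \int[lebesgue_measure]_(x in `[a, b]) p (f x) = p (F b - F a).
  move=> pB fpc Fpc dpF; rewrite /Rintegral (@continuous_FTC2 _ _ (p \o F))//.
    move/(continuous_within_itvP _ ab) : Fpc => [_ Fa Fb].
    by split => // t tab; have [] := dpF t tab.
  move=> t tab; rewrite derive1E; have dt := dpF t tab; exact: derive_val.
move/within_continuous_complexP: fc => [fRe fIm].
move/within_continuous_complexP: Fc => [FRe FIm].
rewrite /complex_lebesgue_integral.
rewrite (real_FTC (@Re R) (raddfB _) fRe FRe (fun t tab => (dFo t tab).1)).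
rewrite (real_FTC (@Im R) (raddfB _) fIm FIm (fun t tab => (dFo t tab).2)).
by case: (F b - F a).
Unshelve. all: by end_near. Qed.

End complex_limits.

(** * Exponential generating functions of geometrically bounded sequences *)

Section egf.
Context {R : realType}.

(** A class stable under shifts and linear combinations whose exponential generating functions
    converge everywhere. Over [R[i]] the order makes [M] and [B] real. *)
Definition geometrically_bounded {K : numDomainType} (a : nat -> K) :=
  exists M B : K, [/\ 0 <= M, 0 <= B & forall i, `|a i| <= M * B ^+ i].

Definition egf (a : nat -> R) (t : R) : R :=
  limn (pseries (fun i => a i / i`!%:R) t).

Lemma is_cvg_egf (a : nat -> R) t : geometrically_bounded a ->
  cvgn (pseries (fun i => a i / i`!%:R) t).
Proof.
move=> [M [B [M0 B0 aMB]]]; apply: normed_cvg.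
apply: (@series_le_cvg _ _ (fun i => M * exp_coeff (B * `|t|) i)).
- by move=> i /=.
- move=> i; apply: mulr_ge0 => //; rewrite /exp_coeff/=.
  by rewrite divr_ge0// exprn_ge0// mulr_ge0.
- move=> i /=; rewrite /exp_coeff /= !normrM normrX exprMn normfV normr_nat.
  have -> : M * (B ^+ i * `|t| ^+ i / i`!%:R) = M * B ^+ i / i`!%:R * `|t| ^+ i.
    by ring.
  by rewrite ler_wpM2r ?exprn_ge0// ler_wpM2r// invr_ge0.
- by apply: is_cvg_seriesZ; exact: is_cvg_series_exp_coeff.
Qed.

Lemma geometrically_bounded_shift {K : numDomainType} (a : nat -> K) :
  geometrically_bounded a -> geometrically_bounded (fun i => a i.+1).
Proof.
move=> [M [B [M0 B0 aMB]]]; exists (M * B), B; split => //.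
  exact: mulr_ge0.
by move=> i; rewrite -mulrA -exprS.
Qed.

Lemma geometrically_boundedZ {K : numDomainType} (c : K) (a : nat -> K) :
  geometrically_bounded a -> geometrically_bounded (fun i => c * a i).
Proof.
move=> [M [B [M0 B0 aMB]]]; exists (`|c| * M), B; split => //.
  exact: mulr_ge0.
by move=> i; rewrite -mulrA normrM ler_wpM2l.
Qed.

Lemma geometrically_boundedD {K : numDomainType} (a b : nat -> K) :
  geometrically_bounded a -> geometrically_bounded b ->
  geometrically_bounded (fun i => a i + b i).
Proof.
move=> [M [B [M0 B0 aMB]]] [N [C [N0 C0 bNC]]].
exists (M + N), (B + C); split; [exact: addr_ge0|exact: addr_ge0|].
move=> i; rewrite (le_trans (ler_normD _ _))// mulrDl lerD//.
  rewrite (le_trans (aMB i))// ler_wpM2l// lerXn2r ?nnegrE ?addr_ge0//.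
  by rewrite lerDl.
rewrite (le_trans (bNC i))// ler_wpM2l// lerXn2r ?nnegrE ?addr_ge0//.
by rewrite lerDr.
Qed.

Lemma geometrically_bounded_sum {K : numDomainType} n (a : 'I_n -> nat -> K) :
  (forall i, geometrically_bounded (a i)) ->
  geometrically_bounded (fun N => \sum_(i < n) a i N).
Proof.
elim: n a => [|n IHn] a ab.
  exists 0, 0; split=> // i; by rewrite big_ord0 normr0 mul0r.
under eq_fun do rewrite big_ord_recl.
by apply: geometrically_boundedD => //; exact: IHn.
Qed.

(** The factorials turn the formal derivative of the power series into the shift of [a]. Termwise
    differentiation asks for convergence of the series and of two formal derivatives farther out
    than [t], here at [|t| + 1]. *)
Lemma is_derive_egf (a : nat -> R) (t : R) : geometrically_bounded a ->
  is_derive t 1 (egf a) (egf (fun i => a i.+1) t).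
Proof.
move=> ab.
have diffsE (b : nat -> R) : pseries_diffs (fun i => b i / i`!%:R) =
    (fun i => b i.+1 / i`!%:R).
  apply/funext => i; rewrite /pseries_diffs factS natrM invfM.
  by rewrite mulrCA mulrA mulrA mulfK ?mulrA //.
have := @pseries_snd_diffs R (fun i => a i / i`!%:R) (`|t| + 1) t.
rewrite !diffsE; apply.
- exact: is_cvg_egf.
- exact: is_cvg_egf (geometrically_bounded_shift ab).
- exact: is_cvg_egf (geometrically_bounded_shift (geometrically_bounded_shift ab)).
- by rewrite [ltRHS]ger0_norm ?ltrDl// addr_ge0.
Qed.

(* The derivative of [sum_i a_i t^i / i!] is the same series for the shifted
   sequence. *)
Definition cegf (a : nat -> R[i]) (t : R) : R[i] :=
  egf (fun i => Re (a i)) t +i* egf (fun i => Im (a i)) t.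

Lemma geometrically_bounded_complex (a : nat -> R[i]) :
  geometrically_bounded a ->
  geometrically_bounded (fun i => Re (a i)) /\
  geometrically_bounded (fun i => Im (a i)).
Proof.
move=> [M [B [M0 B0 aMB]]].
have [M' B'] : M = (Re M)%:C /\ B = (Re B)%:C.
  by rewrite !RRe_real// ?ger0_real.
have MRe : 0 <= Re M by rewrite -ler0c -M'.
have BRe : 0 <= Re B by rewrite -ler0c -B'.
split; exists (Re M), (Re B); split => // i; rewrite -lecR rmorphM rmorphXn/= -M' -B'.
  exact: le_trans (normc_ge_Re _) (aMB i).
exact: le_trans (normc_ge_Im _) (aMB i).
Qed.

Lemma cvg_cegf (a : nat -> R[i]) (t : R) : geometrically_bounded a ->
  series (fun i => a i * t%:C ^+ i / i`!%:R) @ \oo --> cegf a t.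
Proof.
move=> /geometrically_bounded_complex[aRe aIm].
apply/cvg_complexP; split => /=.
  have := @is_cvg_egf _ t aRe; apply: cvg_trans; apply: near_eq_cvg.
  apply: nearW => N; rewrite /pseries /series /= raddf_sum; apply: eq_bigr => i _.
  rewrite -rmorphXn -(rmorph_nat (real_complex R)) [RHS]Re_divR.
  by case: (a i) => x y /=; rewrite mulr0 subr0 mulrAC.
have := @is_cvg_egf _ t aIm; apply: cvg_trans; apply: near_eq_cvg.
apply: nearW => N; rewrite /pseries /series /= raddf_sum; apply: eq_bigr => i _.
rewrite -rmorphXn -(rmorph_nat (real_complex R)) [RHS]Im_divR.
by case: (a i) => x y /=; rewrite mulr0 add0r mulrAC.
Qed.

Lemma cegf_unique (a : nat -> R[i]) (t : R) (l : R[i]) : geometrically_bounded a ->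
  series (fun i => a i * t%:C ^+ i / i`!%:R) @ \oo --> l -> cegf a t = l.
Proof. move=> ga al.
by rewrite -(cvg_complex_lim al) (cvg_complex_lim (@cvg_cegf a t ga)). Qed.

Lemma cegfD (a b : nat -> R[i]) (t : R) :
  geometrically_bounded a -> geometrically_bounded b ->
  cegf (fun i => a i + b i) t = cegf a t + cegf b t.
Proof.
move=> ga gb; apply: cegf_unique; first exact: geometrically_boundedD.
apply: cvg_trans (cvg_complexD (@cvg_cegf a t ga) (@cvg_cegf b t gb)).
 apply: near_eq_cvg; apply: nearW => N.
by rewrite /series /= -big_split; apply: eq_bigr => i _; rewrite /= !mulrDl.
Qed.

Lemma cegfZ (c : R[i]) (a : nat -> R[i]) (t : R) : geometrically_bounded a ->
  cegf (fun i => c * a i) t = c * cegf a t.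
Proof.
move=> ga; apply: cegf_unique; first exact: geometrically_boundedZ.
apply: cvg_trans (cvg_complexM (cvg_cst c) (@cvg_cegf a t ga)).
 apply: near_eq_cvg; apply: nearW => N.
by rewrite /series /= mulr_sumr; apply: eq_bigr => i _; rewrite !mulrA.
Qed.

(** Bounding the support of [a i * t%:C ^+ i] rather than of [a i] also covers the evaluation at
    [t = 0]. *)
Lemma cegf_finite (a : nat -> R[i]) (t : R) K :
  (forall i, (K <= i)%N -> a i * t%:C ^+ i = 0) -> geometrically_bounded a ->
  cegf a t = \sum_(0 <= i < K) a i * t%:C ^+ i / i`!%:R.
Proof.
move=> aK ga; apply: cegf_unique => //; apply: cvg_near_cst; near=> N.
have KN : (K <= N)%N by near: N; exact: nbhs_infty_ge.
rewrite /series /= (@big_cat_nat _ _ _ K)//= [X in _ + X]big_nat_cond [X in _ + X]big1 ?addr0//.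
by move=> i /andP[/andP[Ki _] _]; rewrite aK// mul0r.
Unshelve. all: by end_near. Qed.

Lemma cegf0 (a : nat -> R[i]) : geometrically_bounded a -> cegf a 0 = a 0%N.
Proof.
move=> ga; rewrite (@cegf_finite _ _ 1)//.
  by rewrite big_nat1 expr0 mulr1 divr1.
by move=> [//|i] _; rewrite expr0n mulr0.
Qed.

Lemma cegf_sum n (a : 'I_n -> nat -> R[i]) (t : R) :
  (forall i, geometrically_bounded (a i)) ->
  cegf (fun N => \sum_(i < n) a i N) t = \sum_(i < n) cegf (a i) t.
Proof.
elim: n a => [|n IHn] a ga.
  rewrite big_ord0 (@cegf_finite _ _ 0) ?big_geq//.
    by move=> i _; rewrite big_ord0 mul0r.
  exact: geometrically_bounded_sum.
rewrite big_ord_recl -IHn//.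
under eq_fun do rewrite big_ord_recl.
by apply: cegfD; [exact: ga|exact: geometrically_bounded_sum].
Qed.

Lemma has_cderiv_cegf (D : set R) (a : nat -> R[i]) (t : R) :
  geometrically_bounded a ->
  has_cderiv D (cegf a) t (cegf (fun i => a i.+1) t).
Proof.
move=> /geometrically_bounded_complex[aRe aIm].
by apply: is_derive_has_cderiv; exact: is_derive_egf.
Qed.

Lemma has_cderiv_cegf_rev (D : set R) (a : nat -> R[i]) (x t : R) :
  geometrically_bounded a ->
  has_cderiv D (fun s => cegf a (x - s)) t (- cegf (fun i => a i.+1) (x - t)).
Proof.
have rev (b : nat -> R) : geometrically_bounded b ->
    is_derive t 1 (fun s => egf b (x - s)) (- egf (fun i => b i.+1) (x - t)).
  move=> gb; have db := @is_derive_egf b (x - t) gb.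
  rewrite -[X in is_derive _ _ _ X]mulrN1.
  apply: (@is_derive1_comp _ (egf b) (fun s => x - s)).
  rewrite -[X in is_derive _ _ _ X]add0r; exact: is_deriveB.
move=> /geometrically_bounded_complex[aRe aIm].
by apply: is_derive_has_cderiv; exact: rev.
Qed.

Lemma geometrically_boundedX {K : numDomainType} (z : K) :
  geometrically_bounded (fun i => z ^+ i).
Proof. by exists 1, `|z|; split => // i; rewrite mul1r normrX. Qed.

(** Reduces every fact about exponentials of a real variable to geometric sequences. *)
Lemma cexp_cegf (z : R[i]) (x : R) : cexp (z * x%:C) = cegf (fun i => z ^+ i) x.
Proof.
rewrite /cexp; apply/cvg_complex_lim.
under eq_fun do rewrite exprMn.
by apply: cvg_cegf; exact: geometrically_boundedX.
Qed.

End egf.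

(** * Linear recurrences and the discrete Fourier transform *)

Section recurrence.
Context {F : numFieldType}.

(** Orthogonality of the characters of Z/m: for distinct [r] and [s] this is a geometric sum whose
    ratio is an m-th root of unity other than 1. *)
Lemma sum_prim_root_expr_quotient m (w : F) (r s : nat) :
  m.-primitive_root w -> (r < m)%N -> (s < m)%N ->
  \sum_(j < m) (w ^+ s / w ^+ r) ^+ j = if r == s then m%:R else 0.
Proof.
move=> wm rm sm.
have wr_unit : w ^+ r != 0.
  by rewrite expf_neq0// (prim_root_eq0 wm) -lt0n (prim_order_gt0 wm).
have [<-|rs] := eqVneq r s.
  by rewrite divff// (eq_bigr (fun=> 1)) ?sumr_const ?card_ord// => j _; rewrite expr1n.
apply/eqP; have /eqP := subrX1 (w ^+ s / w ^+ r) m.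
rewrite expr_div_n -!exprM ![(_ * m)%N]mulnC !exprM (prim_expr_order wm) !expr1n.
rewrite divr1 subrr eq_sym mulf_eq0 => /orP[|//].
rewrite subr_eq0 => /eqP/divr1_eq/eqP.
by rewrite (eq_prim_root_expr wm) !modn_small// eq_sym (negbTE rs).
Qed.

(** The window k, ..., n - 1 determines [b] from [k] on, and the powers of each (n-k)-th root of
    gamma satisfy the same recurrence, so it suffices to match the window. If [rho = 0] all the
    roots coincide, hence the requirement n = 1. *)
Lemma recurrence_span n k (gamma rho w : F) (b : nat -> F) :
  (k < n)%N -> (n - k).-primitive_root w -> rho ^+ (n - k) = gamma ->
  (rho != 0) || (n == 1)%N ->
  (forall N, b (N + n)%N = gamma * b (N + k)%N) ->
  exists c : 'I_(n - k) -> F, forall N, (k <= N)%N ->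
    b N = \sum_(j < n - k) c j * (rho * w ^+ j) ^+ N.
Proof.
move=> kn; set m := (n - k)%N => wm rhom rho0 bN.
have m0 : (0 < m)%N by rewrite subn_gt0.
pose lam (j : 'I_m) := rho * w ^+ j.
have lamm j : lam j ^+ m = gamma.
  rewrite exprMn rhom -exprM mulnC exprM (prim_expr_order wm) expr1n mulr1//.
(* Fourier inversion over the window of indices [k + r]. *)
pose c j := m%:R^-1 * \sum_(r < m) b (k + r)%N / lam j ^+ (k + r).
exists c.
have mF : m%:R != 0 :> F by rewrite pnatr_eq0 -lt0n.
have orth (r s : 'I_m) :
    \sum_(j < m) lam j ^+ (k + s) / lam j ^+ (k + r) = if r == s then m%:R else 0.
  (* With [rho = 0] the window is the single index 0, where 0 ^+ 0 = 1. *)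
  have [rho_eq0|rho_neq0] := eqVneq rho 0.
    have n1 : n = 1%N by apply/eqP; move: rho0; rewrite rho_eq0 eqxx.
    have k0 : k = 0%N by move: kn; rewrite n1 ltnS leqn0 => /eqP.
    have m1 : m = 1%N by rewrite /m n1 k0.
    have z0 (i : 'I_m) : i = 0%N :> nat.
      by apply/eqP; rewrite -leqn0 -ltnS; move: (ltn_ord i); rewrite [X in (_ < X)%N]m1.
    rewrite (_ : r == s) ?(eqxx, z0)//; last by apply/eqP/val_inj; rewrite /= !z0.
    rewrite (eq_bigr (fun=> 1)) => [|j _]; last by rewrite k0 !expr0 divr1.
    by rewrite sumr_const card_ord.
  have w0 : w != 0 by rewrite (prim_root_eq0 wm) -lt0n.
  rewrite (eq_bigr (fun j : 'I_m => rho ^+ s / rho ^+ r * (w ^+ s / w ^+ r) ^+ j)).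
    rewrite -mulr_sumr (sum_prim_root_expr_quotient wm)// val_eqE.
    by case: eqVneq => [->|_]; rewrite ?mulr0// divff ?mul1r// expf_neq0.
  move=> j _; rewrite /lam !exprD !exprMn exprVn -!exprM ![(j * _)%N]mulnC.
  by field; rewrite !expf_neq0.
have init (s : 'I_m) : b (k + s)%N = \sum_j c j * lam j ^+ (k + s).
  under eq_bigr do rewrite -mulrA mulr_suml mulr_sumr.
  rewrite exchange_big /=.
  under eq_bigr => r _.
    under eq_bigr => j _.
      rewrite (_ : _ * _ = m%:R^-1 * b (k + r)%N * (lam j ^+ (k + s) / lam j ^+ (k + r))).
        over.
      by ring.
    rewrite -mulr_sumr orth.
    over.
  rewrite /= (bigD1 s)//= eqxx big1 => [|r rs]; last first.
    by rewrite (negbTE rs) mulr0.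
  by rewrite addr0 mulrAC mulVf// mul1r.
move=> N; elim/ltn_ind : N => N IHN kN.
have [Nn|nN] := ltnP N n.
  have Nm : (N - k < m)%N by rewrite ltn_sub2r.
  by have := init (Ordinal Nm); rewrite /= subnKC.
(* [N] drops to [N - n + k], smaller by [m]; the factor lost is [lam j ^+ m = gamma]. *)
rewrite -{1}(subnK nN) bN IHN; last 2 first.
- by rewrite -[ltnRHS](subnK nN) ltn_add2l.
- exact: leq_addl.
rewrite mulr_sumr; apply: eq_bigr => j _; rewrite mulrCA; congr (_ * _).
by rewrite -(lamm j) /lam -exprD addnCA /m (subnK (ltnW kn)) subnK.
Qed.

End recurrence.

(** * The exponential along real lines, Euler's formula and roots of unity *)

Section exponential.
Context {R : realType}.

Lemma has_cderiv0_cst (f : R -> R[i]) (x y : R) :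
  (forall t, has_cderiv [set: R] f t 0) -> f x = f y.
Proof.
move=> df; have intT (t : R) : [set: R]° t by exact: filterT.
have dRI t := has_cderiv_is_derive (intT t) (df t).
have fRe : Re (f x) = Re (f y).
  by apply: (is_derive_0_is_cst (f := fun x => Re (f x))) => t; have [] := dRI t.
have fIm : Im (f x) = Im (f y).
  by apply: (is_derive_0_is_cst (f := fun x => Im (f x))) => t; have [] := dRI t.
by apply/eqP; rewrite eq_complex fRe fIm !eqxx.
Qed.

Lemma has_cderiv_cexp (D : set R) (z : R[i]) (t : R) :
  has_cderiv D (fun x => cexp (z * x%:C)) t (z * cexp (z * t%:C)).
Proof.
under eq_fun do rewrite cexp_cegf.
rewrite cexp_cegf -cegfZ; last exact: geometrically_boundedX.
rewrite (_ : (fun i => z * z ^+ i) = (fun i => z ^+ i.+1)); last first.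
  by apply/funext => i; rewrite exprS.
exact: has_cderiv_cegf (geometrically_boundedX z).
Qed.

Lemma has_cderiv_cexp_rev (D : set R) (z : R[i]) (c t : R) :
  has_cderiv D (fun x => cexp (z * (c - x)%:C)) t (- (z * cexp (z * (c - t)%:C))).
Proof.
under eq_fun do rewrite cexp_cegf.
rewrite cexp_cegf -cegfZ; last exact: geometrically_boundedX.
rewrite (_ : (fun i => z * z ^+ i) = (fun i => z ^+ i.+1)); last first.
  by apply/funext => i; rewrite exprS.
exact: has_cderiv_cegf_rev (geometrically_boundedX z).
Qed.

Lemma cexp0 : cexp (0 : R[i]) = 1.
Proof.
rewrite -(mul0r (0 : R)%:C) cexp_cegf cegf0 ?expr0//.
exact: geometrically_boundedX.
Qed.

(* [f t * cexp (z * (c - t))] is constant when [f' = z f]. *)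
Lemma has_cderiv_linear (f : R -> R[i]) (z : R[i]) (c t : R) :
  (forall s, has_cderiv [set: R] f s (z * f s)) ->
  f t * cexp (z * (c - t)%:C) = f c.
Proof.
move=> df; pose g s := f s * cexp (z * (c - s)%:C).
have -> : f c = g c by rewrite /g subrr mulr0 cexp0 mulr1.
apply: (@has_cderiv0_cst g) => s.
have := has_cderivM (df s) (@has_cderiv_cexp_rev setT z c s).
by congr (has_cderiv _ _ _ _); ring.
Qed.

(** Uniqueness for f' = z f, applied to the exponential itself, based at [s + t] and evaluated at
    [s]. *)
Lemma cexpD (z : R[i]) (s t : R) :
  cexp (z * (s + t)%:C) = cexp (z * s%:C) * cexp (z * t%:C).
Proof.
rewrite -(@has_cderiv_linear (fun x => cexp (z * x%:C)) z (s + t) s).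
  by rewrite addrC addKr.
by move=> x; exact: has_cderiv_cexp.
Qed.

(** Euler's formula: both sides solve f' = i f with value 1 at 0, so both are inverse to the same
    factor exp(-i t). *)
Lemma cexp_i (t : R) : cexp (t%:C * 'i%C) = cos t +i* sin t.
Proof.
pose u (s : R) : R[i] := cos s +i* sin s.
have du s : has_cderiv [set: R] u s ('i%C * u s).
  apply: is_derive_has_cderiv; rewrite /u /= ?mul0r ?mul1r ?add0r ?addr0 ?sub0r.
    exact: is_derive_cos.
  exact: is_derive_sin.
have de s : has_cderiv [set: R] (fun x => cexp ('i%C * x%:C)) s ('i%C * cexp ('i%C * s%:C)).
  exact: has_cderiv_cexp.
have := @has_cderiv_linear u _ 0 t du; rewrite {2}/u cos0 sin0.
have := @has_cderiv_linear _ _ 0 t de; rewrite mulr0 cexp0 => e1 u1.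
have eN0 : cexp ('i%C * (0 - t)%:C) != 0 :> R[i].
  by apply: contra_eq_neq e1 => ->; rewrite mulr0 eq_sym oner_neq0.
by rewrite mulrC; apply: (mulIf eN0); rewrite e1 u1.
Qed.

Lemma cexp_i_expr (t : R) j : cexp ((j%:R * t)%:C * 'i%C) = cexp (t%:C * 'i%C) ^+ j.
Proof.
elim: j => [|j IHj]; first by rewrite mul0r mul0r cexp0.
by rewrite exprS -IHj -natr1 mulrDl mul1r addrC ![_ * 'i%C]mulrC cexpD.
Qed.

(** No smaller power is 1: cos(2 phi) = 1 would force sin phi = 0, whereas phi = pi (i + 1) / m lies
    strictly between 0 and pi when i + 1 < m. *)
Lemma prim_root_cexp m : (0 < m)%N ->
  m.-primitive_root (cexp ((2 * pi / m%:R : R)%:C * 'i%C)).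
Proof.
move=> m0.
have mR : m%:R != 0 :> R by rewrite pnatr_eq0 -lt0n.
apply/andP; split=> //; apply/forallP => i; apply/eqP.
rewrite unity_rootE -cexp_i_expr cexp_i eq_complex /=.
have [im|im] := eqVneq i.+1 m.
  rewrite (_ : _ * _ = pi *+ 2) ?cos2pi ?sin2pi ?eqxx//.
  by rewrite im mulrC divfK// mulr_natl.
apply/negbTE; rewrite negb_and; apply/orP; left.
have im' : (i.+1 < m)%N by rewrite ltn_neqAle im ltn_ord.
have -> : i.+1%:R * (2 * pi / m%:R) = (i.+1%:R * pi / m%:R) *+ 2 :> R.
  by rewrite -mulr_natr; ring.
set phi := i.+1%:R * pi / m%:R.
have : 0 < sin phi.
  apply: sin_gt0_pi; rewrite divr_gt0 ?mulr_gt0 ?pi_gt0 ?ltr0n//=.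
  by rewrite ltr_pdivrMr ?ltr0n// mulrC ltr_pM2l ?pi_gt0// ltr_nat.
apply: contraTneq; rewrite cos_mulr2n => cos1.
have : sin phi ^+ 2 = 0.
  by rewrite sin2cos2; apply/eqP; rewrite subr_eq0; apply/eqP; lra.
by move/eqP; rewrite sqrf_eq0 => /eqP ->; rewrite ltxx.
Qed.

End exponential.

(** * Taylor coefficients of zeta and of its derivative *)

Section zeta.
Context {R : realType}.

(** The N-th derivative of [zeta] at 0. The c_N of the overview is its value at N + 1. *)
Definition zeta_coef (n k : nat) (gamma : R[i]) (N : nat) : R[i] :=
  if (n <= N)%N && (n - k %| N - n)%N then gamma ^+ ((N - n) %/ (n - k)) else 0.

Lemma zeta_coef_bounded n k gamma : geometrically_bounded (zeta_coef n k gamma).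
Proof.
exists 1, (1 + `|gamma|); split; rewrite ?addr_ge0// => N; rewrite mul1r /zeta_coef.
have g1 : 1 <= 1 + `|gamma| by rewrite lerDl.
case: ifP => _; last by rewrite normr0 exprn_ge0// addr_ge0.
rewrite normrX; apply: (@le_trans _ _ ((1 + `|gamma|) ^+ ((N - n) %/ (n - k)))).
  by rewrite lerXn2r ?nnegrE ?addr_ge0// lerDr.
by rewrite ler_weXn2l// (leq_trans (leq_div _ _))// leq_subr.
Qed.

(** The index starts at 1 on purpose: [zeta] solves z^(n) - gamma z^(k) = 1, so the recurrence fails
    at 0; its derivative solves the homogeneous equation. *)
Lemma zeta_coef_rec n k gamma N : (k < n)%N ->
  zeta_coef n k gamma (N.+1 + n) = gamma * zeta_coef n k gamma (N.+1 + k).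
Proof.
move=> kn; rewrite /zeta_coef leq_addl addnK /=.
have m0 : (0 < n - k)%N by rewrite subn_gt0.
have [nNk|Nkn] := leqP n (N.+1 + k).
  have -> : N.+1 = (N.+1 + k - n + (n - k))%N by lia.
  rewrite dvdn_addl ?dvdnn// divnDr ?dvdnn// divnn m0 addn1 exprS.
  have -> : (N.+1 + k - n + (n - k) + k - n = N.+1 + k - n)%N by lia.
  by case: ifP => _ //; rewrite mulr0.
(* Here 0 < N + 1 < n - k, so N + 1 is not divisible by n - k and both sides vanish. *)
by rewrite /= mulr0 gtnNdvd//; lia.
Qed.

Lemma zeta_coef_init n k gamma j : (j <= n)%N -> zeta_coef n k gamma j = (j == n)%:R.
Proof.
move=> jn; rewrite /zeta_coef; have [->|jn'] := eqVneq j n.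
  by rewrite leqnn subnn dvdn0 div0n expr0.
by rewrite leqNgt ltn_neqAle jn' jn.
Qed.

(** The partial sums of [zeta] form a subsequence of those of the power series: [i] terms match the
    coefficients below i (n - k) + n, the exponent of the next term. *)
Lemma zeta_cegf n k gamma : (k < n)%N -> zeta n k gamma = cegf (zeta_coef n k gamma).
Proof.
move=> kn; apply/funext => t; rewrite /zeta; apply: cvg_complex_lim.
have m0 : (0 < n - k)%N by rewrite subn_gt0.
have blocks i : series (fun i =>
      gamma ^+ i * t%:C ^+ (i * (n - k) + n) / (i * (n - k) + n)`!%:R) i =
    series (fun i => zeta_coef n k gamma i * t%:C ^+ i / i`!%:R) (i * (n - k) + n)%N.
  rewrite /series /=; elim: i => [|i IHi].
    rewrite big_geq// big_nat_cond big1// => j /andP[/andP[_ jn] _].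
    by rewrite zeta_coef_init 1?ltnW// ltn_eqF// !mul0r.
  rewrite big_nat_recr//= IHi; set s := (i * (n - k) + n)%N.
  have -> : (i.+1 * (n - k) + n = s + (n - k))%N by rewrite /s; lia.
  rewrite [RHS](@big_cat_nat _ _ _ s)//= ?leq_addr//; congr (_ + _).
  rewrite big_ltn; last by rewrite -{1}[s]addn0 ltn_add2l.
  rewrite {1}/zeta_coef /s leq_addl addnK dvdn_mull ?dvdnn// mulnK//=.
  rewrite big_nat_cond big1 ?addr0// => j /andP[/andP[ij ji] _].
  rewrite /zeta_coef ifF ?mul0r//; apply/negbTE; rewrite negb_and; apply/orP; right.
  have -> : (j - n = i * (n - k) + (j - (i * (n - k) + n)))%N by lia.
  by rewrite dvdn_addr ?dvdn_mull ?dvdnn// gtnNdvd//; lia.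
rewrite (_ : series _ = fun i => series (fun i => zeta_coef n k gamma i * t%:C ^+ i /
    i`!%:R) (i * (n - k) + n)%N); last by apply/funext => i; exact: blocks.
apply: (cvg_comp _ _ _ (@cvg_cegf R _ t (zeta_coef_bounded n k gamma))).
apply/cvgnyPge => A; near=> i.
rewrite (@leq_trans i)//; first by near: i; exact: nbhs_infty_ge.
by rewrite (leq_trans (leq_pmulr i m0))// leq_addr.
Unshelve. all: by end_near. Qed.

Lemma cderiv_zeta n k gamma (t : R) : (k < n)%N ->
  cderiv [set: R] (zeta n k gamma) t = cegf (fun i => zeta_coef n k gamma i.+1) t.
Proof.
move=> kn; rewrite zeta_cegf// /cderiv; apply: cvg_complex_lim.
  by rewrite withinET; exact: Proper_dnbhs_numFieldType.
exact: (@has_cderiv_cegf R setT _ t (zeta_coef_bounded n k gamma)).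
Qed.

End zeta.

Lemma geometrically_bounded_shiftn {K : numDomainType} j (c : nat -> K) :
  geometrically_bounded c -> geometrically_bounded (fun i => c (i + j)%N).
Proof.
move=> cb; elim: j => [|j IHj]; first by under eq_fun do rewrite addn0.
by under eq_fun do rewrite addnS -addSn; exact: geometrically_bounded_shift IHj.
Qed.

(** * Variation of constants by repeated integration by parts *)

Section variation_of_constants.
Context {R : realType}.
Variables (a b x : R) (n k : nat) (gamma : R[i]) (f : nat -> R -> R[i]).
Variable (c : nat -> R[i]).
Hypotheses (axb : x \in `[a, b]) (kn : (k < n)%N).
Hypothesis df : forall m, (m < n)%N -> forall t, t \in `[a, b] ->
  has_cderiv `[a, b] (f m) t (f m.+1 t).
Hypothesis fn : {within `[a, b], continuous (f n)}.
Hypothesis cb : geometrically_bounded c.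
Hypothesis c_rec : forall N, c (N + n)%N = gamma * c (N + k)%N.
Hypothesis c_init : forall j, (j < n)%N -> c j = (j == n.-1)%:R.

(** The j-th derivative of [cegf c]. *)
Let cE j := cegf (fun i => c (i + j)%N).

(* Boundary term of [p] integrations by parts of [f p t * cegf c (x - t)]. *)
Definition green_sum (p : nat) (t : R) : R[i] :=
  \sum_(j < p) f (p - j.+1) t * cE j (x - t).

(** The product rule turns the j-th term into u_j - u_(j+1), the sign coming from the reversed
    argument [x - t]; the sum telescopes. *)
Lemma has_cderiv_green_sum p t : (p <= n)%N -> t \in `[a, b] ->
  has_cderiv `[a, b] (green_sum p) t (f p t * cE 0 (x - t) - f 0 t * cE p (x - t)).
Proof.
move=> pn tab.
have dE j : has_cderiv `[a, b] (fun s => cE j (x - s)) t (- cE j.+1 (x - t)).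
  rewrite (_ : cE j.+1 = cegf (fun i => c (i.+1 + j)%N)).
    exact: (@has_cderiv_cegf_rev R _ _ x t (geometrically_bounded_shiftn j cb)).
  by rewrite /cE; under eq_fun do rewrite addnS -addSn.
pose u j := f (p - j)%N t * cE j (x - t).
rewrite (_ : _ - _ = \sum_(j < p) (u j - u j.+1)).
  apply: has_cderiv_sum => j; rewrite /u -mulrN -(subnSK (ltn_ord j)).
  apply: has_cderivM; last exact: dE.
  by apply: df => //; rewrite (leq_trans _ pn)// -subSn// subSS leq_subr.
rewrite -opprB -[RHS]opprK; congr (- _).
rewrite -sumrN -(big_mkord xpredT (fun j => - (u j - u j.+1))).
under eq_bigr do rewrite opprB.
by rewrite telescope_sumr// /u subn0 subnn.
Qed.

Lemma forcing_continuous :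
  {within `[a, b], continuous (fun t => f n t - gamma * f k t)}.
Proof.
rewrite (_ : (fun t => _) = (fun t => f n t + (- gamma) * f k t)); last first.
  by apply/funext => t; rewrite mulNr.
have fk : {within `[a, b], continuous (f k)}.
  by apply: (@has_cderiv_continuous _ _ _ (f k.+1)) => t tab; exact: df.
apply/subspace_continuousP => t tab.
move/subspace_continuousP: fk => /(_ _ tab) fkt.
move/subspace_continuousP: fn => /(_ _ tab) fnt.
apply: cvg_complexD; first exact: fnt.
by apply: cvg_complexM; [exact: cvg_cst|exact: fkt].
Qed.

(** [W] is a primitive of the integrand: since E_n = gamma E_k, the terms containing [f 0] cancel in
    its derivative. *)
Lemma variation_of_constants :
  f 0 x = (green_sum n a - gamma * green_sum k a) +
    complex_lebesgue_integral `[a, x]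
      (fun t => (f n t - gamma * f k t) * cegf c (x - t)).
Proof.
have [ax xb] : a <= x /\ x <= b by move: axb; rewrite in_itv => /andP.
have cE0 : cE 0 = cegf c by rewrite /cE; under eq_fun do rewrite addn0.
have cEn t : cE n t = gamma * cE k t.
  rewrite /cE -cegfZ; last exact: geometrically_bounded_shiftn.
  congr (cegf _ t); apply/funext => i; exact: c_rec.
pose W t := green_sum n t + (- gamma) * green_sum k t.
pose W' t := (f n t - gamma * f k t) * cegf c (x - t).
have dW t : t \in `[a, b] -> has_cderiv `[a, b] W t (W' t).
  move=> tab; have kn' := ltnW kn.
  have := has_cderivD (has_cderiv_green_sum (leqnn n) tab)
    (@has_cderivZ R _ (- gamma) _ _ _ (has_cderiv_green_sum kn' tab)).
  by congr (has_cderiv _ _ _ _); rewrite /W' cEn cE0; ring.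
have green_x p : (p <= n)%N ->
    green_sum p x = \sum_(j < p) f (p - j.+1)%N x * (j == n.-1 :> nat)%:R.
  move=> pn; apply: eq_bigr => j _; rewrite subrr /cE cegf0 ?add0n ?c_init//.
    exact: leq_trans pn.
  exact: geometrically_bounded_shiftn.
(* At [t = x] only the index [j = n.-1] survives, paired with [f 0]; the sum with [p = k] stops
   before it because k <= n - 1. *)
have Wx : W x = f 0 x.
  rewrite /W (green_x n)// (green_x k (ltnW kn)) [X in _ * X]big1 => [|j _]; last first.
    by rewrite ltn_eqF ?mulr0//; have := ltn_ord j; lia.
  rewrite mulr0 addr0; case: (n) kn => // n' _.
  rewrite big_ord_recr/= eqxx mulr1 subnn big1 ?add0r// => j _.
  by rewrite ltn_eqF ?mulr0.
(* The fundamental theorem asks for [a < x]; for [x = a] the integral is over a point. *)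
rewrite -mulNr -/(W a); move: ax; rewrite le_eqVlt => /predU1P[ax|ax].
  rewrite /complex_lebesgue_integral ax set_itv1 !Rintegral_set1 Wx.
  by rewrite -[0 +i* 0]/(0 : R[i]) addr0.
have sub : `[a, x]%classic `<=` `[a, b]%classic by apply: subset_itvl; rewrite bnd_simp.
suff -> : complex_lebesgue_integral `[a, x] W' = W x - W a.
  by rewrite Wx addrC subrK.
apply: complex_FTC => [//|t tax|].
  by apply: (has_cderiv_subset sub); apply: dW; exact: sub.
have Ec : {within `[a, b], continuous (fun t => cegf c (x - t))}.
  by apply: has_cderiv_continuous => t _; exact: has_cderiv_cegf_rev.
apply: (continuous_subspaceW sub); apply/subspace_continuousP => t tab.
move/subspace_continuousP: Ec => /(_ _ tab) Ect.
move/subspace_continuousP: forcing_continuous => /(_ _ tab) hct.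
exact: (cvg_complexM hct Ect).
Qed.

End variation_of_constants.

(** * Fubini's theorem for bounded kernels on sets of finite measure *)

Section bounded_fubini.
Context d1 d2 (T1 : measurableType d1) (T2 : measurableType d2) (R : realType).
Variable m1 : {sigma_finite_measure set T1 -> \bar R}.
Variable m2 : {sigma_finite_measure set T2 -> \bar R}.
Variables (D1 : set T1) (D2 : set T2) (K : T1 * T2 -> R) (M : R).
Hypotheses (mD1 : measurable D1) (mD2 : measurable D2).
Hypotheses (D1oo : (m1 D1 < +oo)%E) (D2oo : (m2 D2 < +oo)%E).
Hypotheses (mK : measurable_fun setT K) (KM : forall z, `|K z| <= M).

Let bounded_K T (A : set T) (h : T -> T1 * T2) : [bounded K (h x) | x in A].
Proof. by exists M; split => [|r Mr x _ /=]; [exact: num_real|exact: le_trans (KM _) (ltW Mr)]. Qed.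

Let intK2 x : m2.-integrable D2 (fun y => (K (x, y))%:E).
Proof.
apply: (@measurable_bounded_integrable _ _ _ m2 (fun y => K (x, y))) => //.
apply: measurable_funTS; exact: (measurableT_comp mK (pair1_measurable x)).
Qed.

Let intK1 y : m1.-integrable D1 (fun x => (K (x, y))%:E).
Proof.
apply: (@measurable_bounded_integrable _ _ _ m1 (fun x => K (x, y))) => //.
apply: measurable_funTS; exact: (measurableT_comp mK (pair2_measurable y)).
Qed.

(** Fubini's theorem is used over the whole product, so the domain is absorbed into the
    integrand. *)
Let f := (EFin \o K) \_ (D1 `*` D2).

Let intf : (m1 \x m2)%E.-integrable setT f.
Proof.
have mD : measurable (D1 `*` D2) by exact: measurableX.
apply/(integrable_mkcond _ mD).
apply: measurable_bounded_integrable => //.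
- by rewrite /= product_measure1E// lte_mul_pinfty// ge0_fin_numE.
- exact: measurable_funTS.
Qed.

Let fE x y : f (x, y) =
  ((fun x => ((EFin \o (fun y => K (x, y))) \_ D2) y) \_ D1) x.
Proof.
rewrite /f patchE; case: ifPn => [/set_mem[/= D1x D2y]|/negP nD].
  by rewrite !patchE !mem_set.
rewrite !patchE; case: ifPn => // /set_mem D1x; case: ifPn => // /set_mem D2y.
by exfalso; apply: nD; exact: mem_set.
Qed.

Let inner1 x : (\int[m2]_y f (x, y) =
  ((fun x => (\int[m2]_(y in D2) K (x, y))%R%:E) \_ D1) x)%E.
Proof.
under eq_integral do rewrite fE.
rewrite patchE; case: ifPn => xD1; rewrite /patch ?xD1 ?(negbTE xD1).
  rewrite /Rintegral fineK ?integrable_fin_num// [RHS]integral_mkcond.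
  by apply: eq_integral => y _; rewrite patchE.
by rewrite integral0.
Qed.

Let inner2 y : (\int[m1]_x f (x, y) =
  ((fun y => (\int[m1]_(x in D1) K (x, y))%R%:E) \_ D2) y)%E.
Proof.
under eq_integral do rewrite fE.
rewrite [RHS]patchE; case: ifPn => yD2.
  rewrite /Rintegral fineK ?integrable_fin_num// [RHS]integral_mkcond.
  by apply: eq_integral => x _; rewrite !patchE yD2.
rewrite integral0_eq// => x _; rewrite !patchE; case: ifP => //.
by rewrite (negbTE yD2).
Qed.

Lemma bounded_Fubini :
  \int[m1]_(x in D1) \int[m2]_(y in D2) K (x, y) =
  \int[m2]_(y in D2) \int[m1]_(x in D1) K (x, y).
Proof.
rewrite /Rintegral [in LHS]integral_mkcond [in RHS]integral_mkcond.
congr fine.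
under eq_integral do rewrite -inner1.
under [RHS]eq_integral do rewrite -inner2.
exact: Fubini.
Qed.

(** Prepares the recombination of several measures: additivity of the outer integral requires
    integrable inner integrals. *)
Lemma bounded_Fubini_integrable :
  m1.-integrable D1 (fun x => (\int[m2]_(y in D2) K (x, y))%:E).
Proof.
apply/(integrable_mkcond _ mD1).
rewrite [X in _.-integrable _ X](_ : _ = fubini_F m2 f).
  exact: integrable_fubini_F.
by apply/funext => x; rewrite -inner1.
Qed.

End bounded_fubini.

(** * Complex-valued integrands against a positive measure *)

Section cint.
Context {R : realType}.
Local Notation RB := (measurableTypeR R).

(** At Lebesgue measure this unfolds to [complex_lebesgue_integral]; other [m] are the positive
    measures that make up mu. *)
Definition cint (m : {measure set RB -> \bar R}) (D : set RB) (f : RB -> R[i]) : R[i] :=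
  (\int[m]_(x in D) Re (f x)) +i* (\int[m]_(x in D) Im (f x)).

Definition cintegrable (m : {measure set RB -> \bar R}) (D : set RB) (f : RB -> R[i]) :=
  m.-integrable D (fun x => (Re (f x))%:E) /\ m.-integrable D (fun x => (Im (f x))%:E).

Implicit Types (m : {measure set RB -> \bar R}) (D : set RB).

Lemma eq_cint m D f g : {in D, f =1 g} -> cint m D f = cint m D g.
Proof.
by move=> fg; congr (_ +i* _); apply: eq_Rintegral => x xD; rewrite fg.
Qed.

Lemma eq_cintegrable m D f g : measurable D -> {in D, f =1 g} ->
  cintegrable m D f -> cintegrable m D g.
Proof.
move=> mD fg [fRe fIm].
by split; [apply: eq_integrable fRe|apply: eq_integrable fIm] => // x xD; rewrite fg.
Qed.

Lemma cintegrableD m D f g : measurable D -> cintegrable m D f -> cintegrable m D g ->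
  cintegrable m D (fun x => f x + g x).
Proof.
move=> mD [fRe fIm] [gRe gIm]; split.
  by under eq_fun do rewrite raddfD EFinD; exact: integrableD.
by under eq_fun do rewrite raddfD EFinD; exact: integrableD.
Qed.

Lemma cintD m D f g : measurable D -> cintegrable m D f -> cintegrable m D g ->
  cint m D (fun x => f x + g x) = cint m D f + cint m D g.
Proof.
move=> mD [fRe fIm] [gRe gIm]; rewrite /cint.
under eq_Rintegral do rewrite raddfD.
under [X in _ +i* X]eq_Rintegral do rewrite raddfD.
by rewrite !RintegralD.
Qed.

Lemma ReM (z w : R[i]) : Re (z * w) = Re z * Re w - Im z * Im w.
Proof. by case: z w => ? ? []. Qed.

Lemma ImM (z w : R[i]) : Im (z * w) = Re z * Im w + Im z * Re w.
Proof. by case: z w => ? ? []. Qed.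

Lemma integrable_lin m D (u v : RB -> R) (r s : R) : measurable D ->
  m.-integrable D (fun x => (u x)%:E) -> m.-integrable D (fun x => (v x)%:E) ->
  m.-integrable D (fun x => (r * u x + s * v x)%:E).
Proof.
move=> mD iu iv; under eq_fun do rewrite EFinD !EFinM.
by apply: integrableD => //; exact: integrableZl.
Qed.

Lemma Rintegral_lin m D (u v : RB -> R) (r s : R) : measurable D ->
  m.-integrable D (fun x => (u x)%:E) -> m.-integrable D (fun x => (v x)%:E) ->
  \int[m]_(x in D) (r * u x + s * v x) =
  r * \int[m]_(x in D) u x + s * \int[m]_(x in D) v x.
Proof.
move=> mD iu iv.
have iZ c h : m.-integrable D (fun x => (h x)%:E) ->
    m.-integrable D (fun x => (c * h x)%:E).
  by move=> ih; under eq_fun do rewrite EFinM; exact: integrableZl.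
by rewrite RintegralD ?RintegralZl//; exact: iZ.
Qed.

Lemma cintegrableZ m D c f : measurable D -> cintegrable m D f ->
  cintegrable m D (fun x => c * f x).
Proof.
move=> mD [fRe fIm]; split.
  by under eq_fun do rewrite ReM -mulNr; exact: integrable_lin.
by under eq_fun do rewrite ImM; exact: integrable_lin.
Qed.

Lemma cintZ m D c f : measurable D -> cintegrable m D f ->
  cint m D (fun x => c * f x) = c * cint m D f.
Proof.
move=> mD [fRe fIm]; rewrite /cint.
under eq_Rintegral do rewrite ReM -mulNr.
under [X in _ +i* X]eq_Rintegral do rewrite ImM.
by rewrite !Rintegral_lin// mulNr; case: c.
Qed.

Lemma continuous_cintegrable m (a b : R) f : (m `[a, b]%classic < +oo)%E ->
  {within `[a, b], continuous f} -> cintegrable m `[a, b] f.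
Proof.
move=> moo; move/within_continuous_complexP.
have real_int (u : R -> R) : {within `[a, b], continuous u} ->
    m.-integrable `[a, b] (fun x => (u x)%:E).
  move=> cu; apply: (@measurable_bounded_integrable _ _ _ m u) => //.
    by apply: subspace_continuous_measurable_fun.
  have /compact_bounded[M [_ mrt]] := continuous_compact cu (@segment_compact _ a b).
  by exists M; split; rewrite ?num_real // => ? ? ? ?; exact: mrt.
by move=> [/real_int fRe /real_int fIm].
Qed.

End cint.

(** * Convolution kernels on a triangle *)

Section convolution.
Context {R : realType}.
Local Notation RB := (measurableTypeR R).
Local Notation leb := (@lebesgue_measure R).

Lemma cint_subset (m : {measure set RB -> \bar R}) (D E : set RB) f : E `<=` D ->
  (forall x, D x -> ~ E x -> f x = 0) -> cint m D f = cint m E f.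
Proof.
move=> ED f0.
have sub (u : RB -> R) : (forall x, D x -> ~ E x -> u x = 0) ->
    \int[m]_(x in D) u x = \int[m]_(x in E) u x.
  move=> u0; rewrite -[in RHS](setIidr ED) Rintegral_mkcondr.
  apply: eq_Rintegral => x /set_mem Dx; rewrite patchE; case: ifPn => // /negP nE.
  by rewrite u0// => Ex; apply: nE; exact: mem_set.
by congr (_ +i* _); apply: sub => x Dx nEx; rewrite f0.
Qed.

Section cint_fubini.
Variables m1 m2 : {sigma_finite_measure set RB -> \bar R}.
Variables (D1 D2 : set RB) (K : RB * RB -> R[i]) (M : R).
Hypotheses (mD1 : measurable D1) (mD2 : measurable D2).
Hypotheses (D1oo : (m1 D1 < +oo)%E) (D2oo : (m2 D2 < +oo)%E).
Hypotheses (mRe : measurable_fun setT (fun z => Re (K z))).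
Hypotheses (mIm : measurable_fun setT (fun z => Im (K z))).
Hypotheses (KRe : forall z, `|Re (K z)| <= M) (KIm : forall z, `|Im (K z)| <= M).

Lemma cint_Fubini :
  cint m1 D1 (fun x => cint m2 D2 (fun t => K (x, t))) =
  cint m2 D2 (fun t => cint m1 D1 (fun x => K (x, t))).
Proof.
rewrite /cint; congr (_ +i* _).
  exact: (bounded_Fubini mD1 mD2 D1oo D2oo mRe KRe).
exact: (bounded_Fubini mD1 mD2 D1oo D2oo mIm KIm).
Qed.

Lemma cint_Fubini_integrable :
  cintegrable m1 D1 (fun x => cint m2 D2 (fun t => K (x, t))).
Proof.
split => /=.
  exact: (bounded_Fubini_integrable mD1 mD2 D1oo D2oo mRe KRe).
exact: (bounded_Fubini_integrable mD1 mD2 D1oo D2oo mIm KIm).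
Qed.

End cint_fubini.

(** Fubini needs control on the whole line, while [h] is controlled on the interval alone;
    measurability and boundedness survive a cut-off, unlike continuity in general. *)
Lemma continuous_zero_extension (a b : R) (h : RB -> R[i]) :
  {within `[a, b], continuous h} -> exists (h0 : RB -> R[i]) (M : R),
  [/\ measurable_fun setT (fun x => Re (h0 x)),
      measurable_fun setT (fun x => Im (h0 x)),
      forall x, `|Re (h0 x)| <= M /\ `|Im (h0 x)| <= M,
      forall x, x \in `[a, b] -> h0 x = h x &
      forall x, x \notin `[a, b] -> h0 x = 0].
Proof.
have real_extension (u : RB -> R) : {within `[a, b], continuous u} ->
    exists (u0 : RB -> R) M, [/\ measurable_fun setT u0, forall x, `|u0 x| <= M,
      forall x, x \in `[a, b] -> u0 x = u x &
      forall x, x \notin `[a, b] -> u0 x = 0].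
  move=> cu.
  have /compact_bounded[M [_ Mu]] := continuous_compact cu (@segment_compact _ a b).
  (* The bound holds for every real above [M], hence [M + 1]; the maximum with 0 serves the points
     outside the interval. *)
  exists (u \_ `[a, b]), (Num.max 0 (M + 1)); split.
  - apply/(measurable_restrictT _ _).1 => //.
    exact: subspace_continuous_measurable_fun.
  - move=> x; rewrite patchE; case: ifPn => [/set_mem xab|_].
      rewrite le_max; apply/orP; right.
      by apply: Mu; [rewrite ltrDl|exists x].
    by rewrite normr0 le_max lexx.
  - by move=> x xab; rewrite patchE mem_set.
  - by move=> x xab; rewrite patchE memNset//; exact/negP.
move/within_continuous_complexP => [/real_extension[u [M [mu uM uE u0]]]].
move=> /real_extension[v [N [mv vN vE v0]]].
exists (fun x => u x +i* v x), (Num.max M N); split => //=.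
- by move=> x; rewrite !le_max uM vN orbT.
- by move=> x xab; rewrite uE// vE//; case: (h x).
- by move=> x xab; rewrite u0// v0.
Qed.

Section convolution_fubini.
Variables (p : {finite_measure set RB -> \bar R}) (a b : R) (h v : RB -> R[i]).
Hypotheses (ab : a <= b) (ch : {within `[a, b], continuous h}) (cv : continuous v).

(** Cutting [v] off outside [0, b - a] makes it bounded and vanish at negative [x - t], which carves
    the triangle t <= x out of the square; on the triangle no value is lost. *)
Let conv_kernel : exists (K : RB * RB -> R[i]) (M : R), [/\
  measurable_fun setT (fun z => Re (K z)), measurable_fun setT (fun z => Im (K z)),
  forall z, `|Re (K z)| <= M /\ `|Im (K z)| <= M,
  forall x t, x \in `[a, b] -> t \in `[a, x] -> K (x, t) = h t * v (x - t) &
  forall x t, x \in `[a, b] -> t \in `[a, b] -> t \notin `[a, x] -> K (x, t) = 0].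
Proof.
have [h0 [M [mRh mIh hM hE h0E]]] := continuous_zero_extension ch.
have cv' : {within `[0, b - a], continuous v} by exact: continuous_subspaceT.
have [v0 [N [mRv mIv vN vE v0E]]] := continuous_zero_extension cv'.
have mB : measurable_fun setT (fun z : RB * RB => z.1 - z.2).
  exact: measurable_funB.
have comp2 (u : RB -> R) : measurable_fun setT u ->
    measurable_fun setT (fun z : RB * RB => u z.2).
  by move=> mu; exact: (measurableT_comp mu).
have compB (u : RB -> R) : measurable_fun setT u ->
    measurable_fun setT (fun z : RB * RB => u (z.1 - z.2)).
  by move=> mu; exact: (measurableT_comp mu).
exists (fun z => h0 z.2 * v0 (z.1 - z.2)), (M * N + M * N); split.
- under eq_fun do rewrite ReM.
  apply: measurable_funB; apply: measurable_funM.
  + exact: (comp2 _ mRh).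
  + exact: (compB _ mRv).
  + exact: (comp2 _ mIh).
  + exact: (compB _ mIv).
- under eq_fun do rewrite ImM.
  apply: measurable_funD; apply: measurable_funM.
  + exact: (comp2 _ mRh).
  + exact: (compB _ mIv).
  + exact: (comp2 _ mIh).
  + exact: (compB _ mRv).
- move=> z; have [hR hI] := hM z.2; have [vR vI] := vN (z.1 - z.2).
  rewrite ReM ImM; split.
    by rewrite (le_trans (ler_normB _ _))// !normrM lerD// ler_pM.
  by rewrite (le_trans (ler_normD _ _))// !normrM lerD// ler_pM.
- move=> x t; rewrite !in_itv/= => /andP[ax xb] /andP[at_ tx].
  by rewrite hE ?vE// in_itv/=; lra.
- move=> x t; rewrite !in_itv/= => /andP[ax xb] /andP[at_ tb].
  rewrite at_/= -ltNge => xt; rewrite v0E ?mulr0// in_itv/= negb_and -ltNge.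
  by rewrite subr_lt0 xt.
Qed.

Let leboo : (leb `[a, b]%classic < +oo)%E.
Proof. by rewrite compact_finite_measure//; exact: segment_compact. Qed.

Let poo : (p `[a, b]%classic < +oo)%E.
Proof. by rewrite -ge0_fin_numE// fin_num_measure. Qed.

Let outerE K : (forall x t, x \in `[a, b] -> t \in `[a, x] -> K (x, t) = h t * v (x - t)) ->
  (forall x t, x \in `[a, b] -> t \in `[a, b] -> t \notin `[a, x] -> K (x, t) = 0) ->
  forall x, x \in `[a, b] ->
  cint leb `[a, b] (fun t => K (x, t)) = cint leb `[a, x] (fun t => h t * v (x - t)).
Proof.
move=> KE K0 x xab; have [ax xb] : a <= x /\ x <= b by move: xab; rewrite in_itv => /andP.
rewrite (@cint_subset _ _ `[a, x]%classic).
- by apply: eq_cint => t; rewrite inE => tax; rewrite KE.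
- by apply: subset_itvl; rewrite bnd_simp.
- by move=> t tab tax; rewrite K0//; exact/negP.
Qed.

Let innerE K : (forall x t, x \in `[a, b] -> t \in `[a, x] -> K (x, t) = h t * v (x - t)) ->
  (forall x t, x \in `[a, b] -> t \in `[a, b] -> t \notin `[a, x] -> K (x, t) = 0) ->
  forall t, t \in `[a, b] ->
  cint p `[a, b] (fun x => K (x, t)) = h t * cint p `[t, b] (fun x => v (x - t)).
Proof.
move=> KE K0 t tab; have [at_ tb] : a <= t /\ t <= b by move: tab; rewrite in_itv => /andP.
rewrite (@cint_subset _ _ `[t, b]%classic).
- rewrite -cintZ//.
    apply: eq_cint => x; rewrite inE/= in_itv/= => /andP[tx xb].
    by rewrite KE// in_itv/=; lra.
  apply: continuous_cintegrable; first by rewrite -ge0_fin_numE// fin_num_measure.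
  apply: continuous_subspaceT => x; apply: continuous_comp; last exact: cv.
  by apply: continuousB; [exact: cvg_id|exact: cvg_cst].
- by apply: subset_itvr; rewrite bnd_simp.
- move=> x xab; move: (xab); rewrite /= !in_itv/= => /andP[ax xb].
  rewrite xb andbT => /negP; rewrite -ltNge => xt.
  by rewrite K0// in_itv/= at_/= -ltNge.
Qed.

(** Both sides integrate over the triangle a <= t <= x <= b, sliced in [x] or in [t]. *)
Lemma convolution_Fubini :
  cint p `[a, b] (fun x => cint leb `[a, x] (fun t => h t * v (x - t))) =
  cint leb `[a, b] (fun t => h t * cint p `[t, b] (fun x => v (x - t))).
Proof.
have [K [M [mRe mIm KM KE K0]]] := conv_kernel.
transitivity (cint p `[a, b] (fun x => cint leb `[a, b] (fun t => K (x, t)))).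
  by apply: eq_cint => x; rewrite inE => xab; rewrite (outerE KE K0).
rewrite (@cint_Fubini p leb _ _ _ M)//; try by move=> z; have [] := KM z.
by apply: eq_cint => t; rewrite inE => tab; rewrite (innerE KE K0).
Qed.

Lemma convolution_integrable_outer :
  cintegrable p `[a, b] (fun x => cint leb `[a, x] (fun t => h t * v (x - t))).
Proof.
have [K [M [mRe mIm KM KE K0]]] := conv_kernel.
apply: (@eq_cintegrable _ _ _ (fun x => cint leb `[a, b] (fun t => K (x, t)))) => //.
  by move=> x; rewrite inE => xab; rewrite (outerE KE K0).
by apply: (@cint_Fubini_integrable p leb _ _ _ M) => // z; have [] := KM z.
Qed.

Lemma convolution_integrable_inner :
  cintegrable leb `[a, b] (fun t => h t * cint p `[t, b] (fun x => v (x - t))).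
Proof.
have [K [M [mRe mIm KM KE K0]]] := conv_kernel.
apply: (@eq_cintegrable _ _ _ (fun t => cint p `[a, b] (fun x => K (x, t)))) => //.
  by move=> t; rewrite inE => tab; rewrite (innerE KE K0).
have mswap : measurable_fun setT (fun z : RB * RB => (z.2, z.1)).
  exact: measurable_fun_pair.
apply: (@cint_Fubini_integrable leb p _ _ (fun z => K (z.2, z.1)) M) => //.
- exact: (measurableT_comp mRe mswap).
- exact: (measurableT_comp mIm mswap).
- by move=> z; have [] := KM (z.2, z.1).
- by move=> z; have [] := KM (z.2, z.1).
Qed.

End convolution_fubini.
End convolution.

(** * Integration against the complex measure *)

Section complex_integral.
Context {R : realType}.
Local Notation RB := (measurableTypeR R).
Variables (a b : R) (mu : complex_borel_measure a b).

(** The two measures precede [D] and [f] in the quantifiers: they must serve all the intervals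
    [[t, b]] at once. *)
Lemma charge_integralE (nu : {charge set RB -> \bar R}) :
  exists p q : {finite_measure set RB -> \bar R}, forall D f,
    charge_integral nu D f = \int[p]_(x in D) f x - \int[q]_(x in D) f x.
Proof.
rewrite /charge_integral; case: cid => P exN; case: cid => N nuPN.
by exists (jordan_pos nuPN), (jordan_neg nuPN).
Qed.

Lemma complex_integralE :
  exists p1 q1 p2 q2 : {finite_measure set RB -> \bar R}, forall D f,
    complex_integral mu D f =
    (cint p1 D f - cint q1 D f) + 'i%C * (cint p2 D f - cint q2 D f).
Proof.
have [p1 [q1 re]] := charge_integralE (re_charge mu).
have [p2 [q2 im]] := charge_integralE (im_charge mu).
exists p1, q1, p2, q2 => D f; rewrite /complex_integral !re !im.
by apply/eqP; rewrite eq_complex /= !mul0r !mul1r sub0r add0r !eqxx.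
Qed.

(* The finite measures in [complex_integralE] depend on a choice of Hahn
   decompositions, hence the quantification over all of them. *)
Definition mu_integrable (f : R -> R[i]) :=
  forall p : {finite_measure set RB -> \bar R}, cintegrable p `[a, b] f.

Lemma continuous_mu_integrable f :
  {within `[a, b], continuous f} -> mu_integrable f.
Proof.
move=> cf p; apply: continuous_cintegrable => //.
by rewrite -ge0_fin_numE// fin_num_measure.
Qed.

Lemma complex_integralD f g : mu_integrable f -> mu_integrable g ->
  complex_integral mu `[a, b] (fun x => f x + g x) =
  complex_integral mu `[a, b] f + complex_integral mu `[a, b] g.
Proof.
have [p1 [q1 [p2 [q2 muE]]]] := complex_integralE.
by move=> f_int g_int; rewrite !muE !cintD//; ring.
Qed.

Lemma complex_integralZ c f : mu_integrable f ->
  complex_integral mu `[a, b] (fun x => c * f x) =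
  c * complex_integral mu `[a, b] f.
Proof.
have [p1 [q1 [p2 [q2 muE]]]] := complex_integralE.
by move=> f_int; rewrite !muE !cintZ//; ring.
Qed.

Lemma eq_complex_integral (f g : R -> R[i]) : (forall x, x \in `[a, b] -> f x = g x) ->
  complex_integral mu `[a, b] f = complex_integral mu `[a, b] g.
Proof.
have [p1 [q1 [p2 [q2 muE]]]] := complex_integralE.
move=> fg; have {}fg : {in `[a, b]%classic, f =1 g} by move=> x; rewrite inE; exact: fg.
by rewrite !muE !(eq_cint _ fg).
Qed.

(** Fubini holds for each of the four positive measures, and linearity reassembles them under one
    Lebesgue integral. The integrability clause allows the integral of P plus the convolution to be
    split. *)
Lemma complex_integral_convolution (h v : R -> R[i]) : a <= b ->
  {within `[a, b], continuous h} -> continuous v ->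
  mu_integrable (fun x => complex_lebesgue_integral `[a, x] (fun t => h t * v (x - t))) /\
  complex_integral mu `[a, b]
    (fun x => complex_lebesgue_integral `[a, x] (fun t => h t * v (x - t))) =
  complex_lebesgue_integral `[a, b]
    (fun t => h t * complex_integral mu `[t, b] (fun x => v (x - t))).
Proof.
move=> ab ch cv; split; first by move=> p; exact: convolution_integrable_outer.
have [p1 [q1 [p2 [q2 muE]]]] := complex_integralE.
rewrite muE -![complex_lebesgue_integral]/(cint lebesgue_measure).
rewrite !convolution_Fubini//.
pose J (p : {finite_measure set RB -> \bar R}) t :=
  h t * cint p `[t, b] (fun x => v (x - t)).
have iJ p : cintegrable lebesgue_measure `[a, b] (J p).
  exact: convolution_integrable_inner.
transitivity (cint lebesgue_measure `[a, b] (fun t =>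
    (J p1 t + (-1) * J q1 t) + 'i%C * (J p2 t + (-1) * J q2 t))); last first.
  by apply: eq_cint => t _; rewrite muE /J; ring.
have iB p q : cintegrable lebesgue_measure `[a, b] (fun t => J p t + (-1) * J q t).
  by apply: cintegrableD => //; exact: cintegrableZ.
have cB p q : cint lebesgue_measure `[a, b] (fun t => J p t + (-1) * J q t) =
    cint lebesgue_measure `[a, b] (J p) - cint lebesgue_measure `[a, b] (J q).
  by rewrite cintD// ?cintZ ?mulN1r//; exact: cintegrableZ.
by rewrite cintD ?cintZ ?cB//; exact: cintegrableZ.
Qed.

End complex_integral.

(** * Functions annihilated by the measure *)

Section annihilation.
Context {R : realType}.
Variables (a b : R) (mu : complex_borel_measure a b).

Lemma continuous_cegf (c : nat -> R[i]) : geometrically_bounded c -> continuous (cegf c).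
Proof.
move=> cb x; have : {within [set: R], continuous (cegf c)}.
  by apply: has_cderiv_continuous => t _; exact: has_cderiv_cegf.
by move=> /subspace_continuousP/(_ x I); rewrite withinET.
Qed.

(** Integrability is recorded because linearity of the integral requires it; the condition is then
    stable under linear combinations. *)
Definition null (f : R -> R[i]) :=
  mu_integrable a b f /\ complex_integral mu `[a, b] f = 0.

Lemma nullZ c f : null f -> null (fun x => c * f x).
Proof.
move=> [fi f0]; split; last by rewrite complex_integralZ// f0 mulr0.
by move=> p; exact: cintegrableZ.
Qed.

Lemma nullD f g : null f -> null g -> null (fun x => f x + g x).
Proof.
move=> [fi f0] [gi g0]; split; last by rewrite complex_integralD// f0 g0 addr0.
by move=> p; exact: cintegrableD.
Qed.

Lemma null_sum n (f : 'I_n -> R -> R[i]) :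
  (forall i, null (f i)) -> null (fun x => \sum_(i < n) f i x).
Proof.
elim: n f => [|n IHn] f f0; last first.
  under eq_fun do rewrite big_ord_recl.
  by apply: nullD => //; exact: IHn.
under eq_fun do rewrite big_ord0 -(mul0r (0 : R[i])).
have c0 : mu_integrable a b (fun=> 0 : R[i]).
  by apply: continuous_mu_integrable; apply: continuous_subspaceT => x; exact: cvg_cst.
split; first by move=> p; exact: cintegrableZ.
by rewrite complex_integralZ// mul0r.
Qed.

Lemma null_continuous f : continuous f ->
  complex_integral mu `[a, b] f = 0 -> null f.
Proof.
move=> cf f0; split => //.
by apply: continuous_mu_integrable; exact: continuous_subspaceT.
Qed.

Variables (n k : nat) (gamma : R[i]).
Hypothesis kn : (k < n)%N.
Hypothesis gamma_neq0 : gamma <> 0 \/ n = 1%N.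
Hypothesis moments : forall i : nat, (i < k)%N ->
  complex_integral mu `[a, b] (fun x => x%:C ^+ i) = 0.
Hypothesis exp_moments : forall j : nat, (j < n - k)%N ->
  complex_integral mu `[a, b]
    (fun x => cexp ((n - k).-root gamma *
      cexp ((2 * j%:R * pi / (n - k)%:R)%:C * 'i%C) * x%:C)) = 0.

Lemma null_monomial i : (i < k)%N -> null (fun x => x%:C ^+ i).
Proof.
move=> ik; apply: null_continuous; last exact: moments.
elim: i {ik} => [|i IHi] x; first by under eq_fun do rewrite expr0; exact: cvg_cst.
under eq_fun do rewrite exprS; apply: cvg_complexM (IHi x).
by apply/cvg_complexP; split => /=; [exact: cvg_id|exact: cvg_cst].
Qed.

(** P is expanded around [a], the moments around 0; the binomial formula passes between them. *)
Lemma null_shifted_monomial i (c : R) : (i < k)%N -> null (fun x => (x - c)%:C ^+ i).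
Proof.
move=> ik; under eq_fun do rewrite rmorphB exprDn.
apply: null_sum => j; rewrite [X in null X](_ : _ = fun x =>
  ((- c%:C) ^+ j *+ 'C(i, j)) * x%:C ^+ (i - j)).
  by apply: nullZ; apply: null_monomial; rewrite (leq_ltn_trans (leq_subr _ _)).
by apply/funext => x; rewrite [RHS]mulrnAl [in RHS]mulrC.
Qed.

Lemma null_shifted_exp (lambda : R[i]) (c : R) :
  complex_integral mu `[a, b] (fun x => cexp (lambda * x%:C)) = 0 ->
  null (fun x => cexp (lambda * (x - c)%:C)).
Proof.
move=> l0; under eq_fun do rewrite addrC cexpD.
apply: nullZ; apply: null_continuous => // x.
under eq_fun do rewrite cexp_cegf.
by apply: continuous_cegf; exact: geometrically_boundedX.
Qed.

(** [S] combines geometric sequences and agrees with [s] from index [k] on, so [r = s - S] generates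
    a polynomial of degree below [k], killed by the moments, and [S] a sum of exponentials, killed
    by the other conditions. *)
Lemma null_recurrent (c : R) (s : nat -> R[i]) : geometrically_bounded s ->
  (forall N, s (N + n)%N = gamma * s (N + k)%N) -> null (fun x => cegf s (x - c)).
Proof.
move=> sb s_rec; set m := (n - k)%N; have m0 : (0 < m)%N by rewrite subn_gt0.
pose rho := m.-root gamma; pose w : R[i] := cexp ((2 * pi / m%:R : R)%:C * 'i%C).
have rhom : rho ^+ m = gamma by exact: rootCK.
have rho0 : (rho != 0) || (n == 1)%N.
  case: gamma_neq0 => [/eqP g0|->]; last by rewrite orbT.
  by move: g0; rewrite -rhom expf_eq0 m0 /= => ->.
have [d dE] := recurrence_span kn (prim_root_cexp m0) rhom rho0 s_rec.
pose lam (j : 'I_m) := rho * w ^+ j.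
pose S N := \sum_(j < m) d j * lam j ^+ N.
have expb j : geometrically_bounded (fun N => d j * lam j ^+ N).
  by apply: geometrically_boundedZ; exact: geometrically_boundedX.
have Sb : geometrically_bounded S by exact: geometrically_bounded_sum.
pose r N := s N + (-1) * S N.
have rb : geometrically_bounded r.
  by apply: geometrically_boundedD => //; exact: geometrically_boundedZ.
have sE t : cegf s t = (\sum_(i < k) (r i / i`!%:R) * t%:C ^+ i) +
    \sum_(j < m) d j * cexp (lam j * t%:C).
  have -> : s = (fun N => r N + S N) by apply/funext => N; rewrite /r mulN1r subrK.
  rewrite cegfD// (@cegf_finite _ r _ k)//; last first.
    by move=> N kN; rewrite /r /S dE// mulN1r subrr mul0r.
  rewrite cegf_sum// big_mkord; congr (_ + _); apply: eq_bigr => i _.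
    by rewrite mulrAC.
  rewrite cegfZ ?cexp_cegf//; exact: geometrically_boundedX.
under eq_fun do rewrite sE; apply: nullD; apply: null_sum => i; apply: nullZ.
  exact: null_shifted_monomial.
apply: null_shifted_exp.
have wi : w ^+ i = cexp ((2 * i%:R * pi / m%:R)%:C * 'i%C).
  rewrite -cexp_i_expr; have -> : i%:R * (2 * pi / m%:R) = 2 * i%:R * pi / m%:R :> R.
    by ring.
  by [].
by rewrite /lam wi exp_moments.
Qed.

(** The factors [f (p - j.+1) c] are constant in [x], and shifting [s] by [j] preserves the
    recurrence. *)
Lemma null_green_sum (f : nat -> R -> R[i]) (s : nat -> R[i]) p (c : R) :
  geometrically_bounded s -> (forall N, s (N + n)%N = gamma * s (N + k)%N) ->
  null (fun x => green_sum x f s p c).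
Proof.
move=> sb s_rec; apply: null_sum => j; apply: nullZ; apply: null_recurrent.
  exact: geometrically_bounded_shiftn.
by move=> N; rewrite addnAC s_rec [in RHS]addnAC.
Qed.

End annihilation.

Theorem theorem3p2 (R : realType) (a b : R) (hab : a < b)
  (mu : complex_borel_measure a b)
  (hmu : exists A : set (measurableTypeR R),
    [/\ measurable A, A `<=` `[a, b] & mu A <> 0])
  (n k : nat) (hkn : (k < n)%N) (gamma : R[i])
  (hgamma : gamma <> 0 \/ n = 1%N)
  (hpow : forall i : nat, (i < k)%N ->
    complex_integral mu `[a, b] (fun x => x%:C ^+ i) = 0)
  (hexp : forall j : nat, (j < n - k)%N ->
    complex_integral mu `[a, b]
      (fun x => cexp ((n - k).-root gamma *
                      cexp ((2 * j%:R * pi / (n - k)%:R)%:C * 'i%C) * x%:C)) = 0) :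
  let g (t : R) : R[i] :=
    complex_integral mu `[t, b]
      (fun x => cderiv [set: R] (zeta n k gamma) (x - t)) in
  forall f : R -> R[i], class_C `[a, b] n f ->
    complex_integral mu `[a, b] f =
    complex_lebesgue_integral `[a, b]
      (fun t => (cderivn `[a, b] n f t - gamma * cderivn `[a, b] k f t) * g t).
Proof.
move=> g f [f_derivable fn_continuous].
pose F m := cderivn `[a, b] m f.
(* The derivative in [g] shifts the coefficients by one, which makes the recurrence valid from index
   0. *)
pose y i := zeta_coef n k gamma i.+1.
have yb : geometrically_bounded y.
  by apply: geometrically_bounded_shift; exact: zeta_coef_bounded.
have y_rec N : y (N + n)%N = gamma * y (N + k)%N.
  by rewrite /y -!addSn zeta_coef_rec.
have y_init j : (j < n)%N -> y j = (j == n.-1)%:R.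
  by move=> jn; rewrite /y zeta_coef_init//; congr (_%:R); case: (n) jn.
(* [cvg] of a filter means convergence to its [lim], so derivability already is [has_cderiv]. *)
have dF m : (m < n)%N -> forall t, t \in `[a, b] ->
    has_cderiv `[a, b] (F m) t (F m.+1 t).
  by move=> mn t tab; exact: (f_derivable m mn t tab).
pose h t := F n t - gamma * F k t.
have ch : {within `[a, b], continuous h} by exact: forcing_continuous hkn dF fn_continuous.
have [conv_int convE] := complex_integral_convolution mu (ltW hab) ch (continuous_cegf yb).
(* The boundary terms at [t = a], seen as a function of [x]. *)
pose P x := green_sum x F y n a + (- gamma) * green_sum x F y k a.
have [P_int P0] : null mu P.
  have null_green p := @null_green_sum R a b mu n k gamma hkn hgamma hpow hexp F y p a
    yb y_rec.
  by apply: nullD; last apply: nullZ; exact: null_green.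
pose conv x := complex_lebesgue_integral `[a, x] (fun t => h t * cegf y (x - t)).
transitivity (complex_integral mu `[a, b] (fun x => P x + conv x)).
  apply: eq_complex_integral => x xab; rewrite /P mulNr.
  exact: (variation_of_constants xab hkn dF fn_continuous yb y_rec y_init).
rewrite complex_integralD// P0 add0r convE.
congr (complex_lebesgue_integral _ _); apply/funext => t; congr (_ * _).
by rewrite /g; congr (complex_integral _ _ _); apply/funext => x; rewrite cderiv_zeta.
Qed.
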